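(* Let $Q$ be a finite quiver and let $H$ be an analytic endomorphism of $\widehat{\mathbb CQ}$. If $H$ induces an isomorphism on $\widetilde{\mathfrak m}/\widetilde{\mathfrak m}^2$, then the compositional inverse $H^{\langle-1\rangle}$ of $H$ (exists and) is analytic.
   Context: $l=\mathbb CQ_0$; $\widehat{\mathbb CQ}$ is the path algebra of $Q$ completed at the arrow ideal, whose elements are formal series $\sum_wa_ww$ over paths $w$ ($|w|$ denotes the length). A series is analytic if there is $C>0$ with $|a_w|\le C^{|w|}$ for all $w$ with $|w|$ sufficiently large; analytic series form a subalgebra $\widetilde{\mathbb CQ}$. $\widehat{\mathfrak m}$ is the closed ideal of $\widehat{\mathbb CQ}$ generated by the arrows and $\widetilde{\mathfrak m}=\widehat{\mathfrak m}\cap\widetilde{\mathbb CQ}$. An endomorphism means an $l$-algebra endomorphism of $\widehat{\mathbb CQ}$; it is called analytic if it maps analytic series to analytic series. *)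

(* Defs.v *)
From HB Require Import structures.
From mathcomp Require Import all_boot all_order all_algebra.
From mathcomp Require Export ring_quotient.
From mathcomp Require Import boolp classical_sets functions reals.
From mathcomp Require Export complex.

Set Implicit Arguments.
Unset Strict Implicit.
Unset Printing Implicit Defensive.

Import Order.TTheory GRing.Theory Num.Theory.
Local Open Scope ring_scope.

Record quiver := Quiver {
  qvert : finType;
  qarr : finType;
  qsrc : qarr -> qvert;
  qtgt : qarr -> qvert }.

(* A path is its starting vertex together with a sequence of arrows, read from *)
(* left to right; the trivial path at i is (i, [::]).                          *)
Fixpoint composable (Q : quiver) (i : qvert Q) (s : seq (qarr Q)) : bool :=
  if s is a :: s' then (qsrc a == i) && composable (qtgt a) s' else true.

Record qpath (Q : quiver) := QPath {
  pstart : qvert Q;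
  parrows : seq (qarr Q);
  pathP : composable pstart parrows }.

Definition pend (Q : quiver) (i : qvert Q) (s : seq (qarr Q)) : qvert Q :=
  last i (map (@qtgt Q) s).

Definition plen (Q : quiver) (w : qpath Q) : nat := size (parrows w).

Lemma qpath_inj (Q : quiver) (u v : qpath Q) :
  pstart u = pstart v -> parrows u = parrows v -> u = v.
Proof.
by case: u v => [i s p] [j t q] /= ei es; subst j t; rewrite (bool_irrelevance p q).
Qed.

Lemma composable_cat (Q : quiver) (i : qvert Q) (s t : seq (qarr Q)) :
  composable i (s ++ t) = composable i s && composable (pend i s) t.
Proof. by elim: s i => //= a s IH i; rewrite IH andbA. Qed.

Lemma ptake_proof (Q : quiver) (k : nat) (w : qpath Q) :
  composable (pstart w) (take k (parrows w)).
Proof.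
by have := pathP w; rewrite -{1}(cat_take_drop k (parrows w)) composable_cat => /andP[].
Qed.

Lemma pdrop_proof (Q : quiver) (k : nat) (w : qpath Q) :
  composable (pend (pstart w) (take k (parrows w))) (drop k (parrows w)).
Proof.
by have := pathP w; rewrite -{1}(cat_take_drop k (parrows w)) composable_cat => /andP[].
Qed.

Definition ptriv (Q : quiver) (i : qvert Q) : qpath Q := @QPath Q i [::] isT.

Lemma parrow_proof (Q : quiver) (a : qarr Q) : composable (qsrc a) [:: a].
Proof. by rewrite /= eqxx. Qed.

Definition parrow (Q : quiver) (a : qarr Q) : qpath Q := QPath (parrow_proof a).

(* w = (ptake k w) (pdrop k w), the first factor having length k when          *)
(* k <= plen w.                                                                *)
Definition ptake (Q : quiver) (k : nat) (w : qpath Q) : qpath Q :=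
  QPath (ptake_proof k w).
Definition pdrop (Q : quiver) (k : nat) (w : qpath Q) : qpath Q :=
  QPath (pdrop_proof k w).

(* The completed path algebra: formal series, i.e. arbitrary coefficient       *)
(* functions on paths, with the convolution product.                           *)
Definition pseries (K : comNzRingType) (Q : quiver) : Type := qpath Q -> K.

Section PathSeries.
Variables (K : comNzRingType) (Q : quiver).
Local Notation A := (pseries K Q).
Implicit Types (f g h : A) (w : qpath Q).

HB.instance Definition _ := GRing.Zmodule.copy A (qpath Q -> K).

Definition pmul f g : A :=
  fun w => \sum_(k < (plen w).+1) f (ptake k w) * g (pdrop k w).

(* The embedding of l, the product of copies of K indexed by the vertices.     *)
Definition lconst (c : qvert Q -> K) : A :=
  fun w => if plen w == 0%N then c (pstart w) else 0.

Definition pone : A := lconst (fun=> 1).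

Lemma ptake_ptake i j w : (i <= j)%N -> ptake i (ptake j w) = ptake i w.
Proof. by move=> ij; apply: qpath_inj => //=; rewrite take_takel. Qed.

Lemma pdrop_pdrop i j w : pdrop i (pdrop j w) = pdrop (i + j) w.
Proof.
apply: qpath_inj => /=; last by rewrite drop_drop.
by rewrite /pend -last_cat -map_cat addnC takeD.
Qed.

Lemma ptake_pdrop i j w : ptake i (pdrop j w) = pdrop j (ptake (j + i) w).
Proof.
apply: qpath_inj => /=; first by rewrite take_takel ?leq_addr.
by rewrite take_drop addnC.
Qed.

Lemma plen_take k w : (k <= plen w)%N -> plen (ptake k w) = k.
Proof. by move=> kw; rewrite /plen /= size_takel. Qed.

Lemma plen_drop k w : plen (pdrop k w) = (plen w - k)%N.
Proof. by rewrite /plen /= size_drop. Qed.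

Lemma ptake_id w : ptake (plen w) w = w.
Proof. by apply: qpath_inj => //=; rewrite take_size. Qed.

Lemma pdrop0 w : pdrop 0 w = w.
Proof. by apply: qpath_inj => /=; rewrite ?take0 ?drop0. Qed.

Lemma pmulA : associative pmul.
Proof.
move=> f g h; apply/funext => w; rewrite /pmul.
pose F i j := f (ptake i w) * (g (pdrop i (ptake j w)) * h (pdrop j w)).
transitivity (\sum_(0 <= i < (plen w).+1) \sum_(i <= j < (plen w).+1) F i j).
  rewrite big_mkord; apply: eq_bigr => -[i /=]; rewrite ltnS => iw _.
  rewrite -[X in \sum_(X <= _ < _) _](add0n i) big_addn subSn // big_mkord.
  rewrite plen_drop big_distrr /=.
  apply: eq_bigr => j _; rewrite /F ptake_pdrop pdrop_pdrop.
  by rewrite (addnC i).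
transitivity (\sum_(0 <= j < (plen w).+1) \sum_(0 <= i < j.+1) F i j); last first.
  rewrite big_mkord; apply: eq_bigr => -[j /=]; rewrite ltnS => jw _.
  rewrite big_mkord plen_take // big_distrl /=; apply: eq_bigr => -[i /=].
  by rewrite ltnS => ij _; rewrite /F ptake_ptake // mulrA.
under eq_bigr => i _ do rewrite (big_nat_widenl _ 0) //.
rewrite (exchange_big_dep_nat xpredT) //=.
apply: eq_big_nat => j /andP[_ jw].
by rewrite [RHS](big_nat_widen _ _ (plen w).+1).
Qed.

Lemma lconstM c f w : pmul (lconst c) f w = c (pstart w) * f w.
Proof.
rewrite /pmul big_ord_recl /= /lconst plen_take //= pdrop0 big1 ?addr0 // => i _.
by rewrite plen_take ?mul0r //= ltn_ord.
Qed.

Lemma Mlconst c f w : pmul f (lconst c) w = f w * c (pend (pstart w) (parrows w)).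
Proof.
rewrite /pmul big_ord_recr /= /lconst plen_drop subnn /= ptake_id take_size.
rewrite big1 ?add0r // => i _.
by rewrite plen_drop subn_eq0 leqNgt ltn_ord mulr0.
Qed.

Lemma pmul1f : left_id pone pmul.
Proof. by move=> f; apply/funext => w; rewrite lconstM mul1r. Qed.

Lemma pmulf1 : right_id pone pmul.
Proof. by move=> f; apply/funext => w; rewrite Mlconst mulr1. Qed.

Lemma pmulDl : left_distributive pmul +%R.
Proof.
move=> f g h; apply/funext => w; rewrite -[RHS]/(pmul f h w + pmul g h w) /pmul.
rewrite -big_split /=; by apply: eq_bigr => i _; rewrite -mulrDl.
Qed.

Lemma pmulDr : right_distributive pmul +%R.
Proof.
move=> f g h; apply/funext => w; rewrite -[RHS]/(pmul f g w + pmul f h w) /pmul.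
rewrite -big_split /=; by apply: eq_bigr => i _; rewrite -mulrDr.
Qed.

(* The ring is zero when Q has no vertex, hence only a pzRingType.             *)
HB.instance Definition _ :=
  GRing.Zmodule_isPzRing.Build A pmulA pmul1f pmulf1 pmulDl pmulDr.

Definition arrow_series (a : qarr Q) : A :=
  fun w => if parrows w == [:: a] then 1 else 0.

Definition two_sided_ideal (I : set A) : Prop :=
  [/\ I 0, (forall f g, I f -> I g -> I (f + g)),
      (forall f g, I g -> I (f * g)) & (forall f g, I f -> I (f * g))].

(* Closedness for the arrow-adic topology: the series vanishing on all paths   *)
(* of length < n form a basis of neighbourhoods of 0.                          *)
Definition adic_closed (I : set A) : Prop :=
  forall f, (forall n, exists2 g, I g & forall w, (plen w < n)%N -> f w = g w) ->
  I f.

Definition mhat : set A := fun f =>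
  forall I : set A, two_sided_ideal I -> adic_closed I ->
    (forall a, I (arrow_series a)) -> I f.

(* l-linearity forces linearity over K, as the scalars lie in l.               *)
Definition l_algebra_endo (H : {rmorphism A -> A}) : Prop :=
  forall c : qvert Q -> K, H (lconst c) = lconst c.

Lemma mhat_ideal : two_sided_ideal mhat.
Proof.
split=> [I [] //|f g mf mg I iI cI aI|f g mg I iI cI aI|f g mf I iI cI aI].
- by case: (iI) => _ D _ _; apply: D; [apply: mf|apply: mg].
- by case: (iI) => _ _ L _; apply: L; apply: mg.
- by case: (iI) => _ _ _ L; apply: L; apply: mf.
Qed.

Lemma pseries0E w : (0 : A) w = 0. Proof. by []. Qed.
Lemma pseriesDE f g w : (f + g) w = f w + g w. Proof. by []. Qed.
Lemma pseriesNE f w : (- f) w = - f w. Proof. by []. Qed.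
Lemma pseriesME f g w :
  (f * g) w = \sum_(k < (plen w).+1) f (ptake k w) * g (pdrop k w).
Proof. by []. Qed.
Lemma pseries_sumE (T : Type) (r : seq T) (P : pred T) (F : T -> A) w :
  (\sum_(i <- r | P i) F i) w = \sum_(i <- r | P i) F i w.
Proof. by elim/big_rec2: _ => // i x y _ <-. Qed.

Lemma mhatP f : mhat f <-> forall i, f (ptriv i) = 0.
Proof.
split=> [mf | f0].
  apply: (mf (fun f => forall i, f (ptriv i) = 0)).
  - split=> [//|g h g0 h0 i|g h h0 i|g h g0 i].
    + by rewrite pseriesDE g0 h0 addr0.
    + rewrite pseriesME big_ord_recl big_ord0 /= addr0.
      by rewrite [X in h X](_ : _ = ptriv i) ?h0 ?mulr0 //; apply: qpath_inj.
    + rewrite pseriesME big_ord_recl big_ord0 /= addr0.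
      by rewrite [X in g X](_ : _ = ptriv i) ?g0 ?mul0r //; apply: qpath_inj.
  - by move=> g ga i; have [h h0 ->] := ga 1%N.
  - by [].
have cons_proof (a : qarr Q) w : (qtgt a == pstart w) ->
    composable (qsrc a) (a :: parrows w).
  by move=> /eqP e; rewrite /= eqxx e pathP.
pose F (a : qarr Q) : A := fun w =>
  if boolP (qtgt a == pstart w) is AltTrue p then f (QPath (cons_proof a w p)) else 0.
have -> : f = \sum_a arrow_series a * F a.
  apply/funext => w; rewrite pseries_sumE.
  case: w => i [|a s] p.
    rewrite (_ : QPath p = ptriv i); last exact: qpath_inj.
    rewrite f0 big1 // => a _; rewrite pseriesME big_ord_recl big_ord0 /=.
    by rewrite mul0r addr0.
  have aE b : (arrow_series b * F b) (QPath p) =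
      (if b == a then 1 else 0) * F b (pdrop 1 (QPath p)).
    rewrite pseriesME big_ord_recl big_ord_recl /= {1}/arrow_series /= mul0r add0r.
    rewrite big1 ?addr0 => [|k _].
      by rewrite /arrow_series /= take0 eqseq_cons eqxx andbT eq_sym.
    rewrite /arrow_series /= ; case: eqP; rewrite ?mul0r // => /(congr1 size) /=.
    rewrite size_takel; last by rewrite ltn_ord.
    by [].
  rewrite (bigD1 a) //= big1 ?addr0 => [|b /negPf ba]; last by rewrite aE ba mul0r.
  rewrite aE eqxx mul1r /F; case: {-}_ / boolP => [q|]; last first.
    by rewrite /= /pend /= take0 /= eqxx.
  congr f; apply: qpath_inj => /=; last by rewrite drop0.
  by case/andP: (p) => /eqP.
move=> I [I0 ID _ IM] _ Ia; elim/big_ind: _ => // a _; exact: IM.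
Qed.

End PathSeries.

Section Analytic.
Variables (R : realType) (Q : quiver).
Local Notation A := (pseries R[i] Q).
Implicit Types f g : A.

Definition analytic f : Prop :=
  exists C : R, 0 < C /\
  exists N : nat, forall w, (N <= plen w)%N -> `|f w| <= (C ^+ plen w)%:C%C.

Definition analytic_endo (H : {rmorphism A -> A}) : Prop :=
  forall f, analytic f -> analytic (H f).

Lemma analytic0 : analytic 0.
Proof.
by exists 1; split=> //; exists 0%N => w _; rewrite normr0 expr1n ler01.
Qed.

Lemma analyticN f : analytic f -> analytic (- f).
Proof.
case=> C [C0 [N fN]]; exists C; split=> //; exists N => w.
by rewrite normrN; apply: fN.
Qed.

Lemma analyticD f g : analytic f -> analytic g -> analytic (f + g).
Proof.
move=> [C [C0 [M fM]]] [D [D0 [N gN]]].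
exists (C + D); split; first exact: addr_gt0.
exists (maxn 1 (maxn M N)) => w; rewrite !geq_max => /and3P[w1 wM wN].
apply: (le_trans (ler_normD _ _)); apply: (le_trans (lerD (fM _ wM) (gN _ wN))).
rewrite -rmorphD /= lecR; case: (plen w) w1 => // n _.
have H (x : R) : 0 < x -> x <= C + D -> x * x ^+ n <= x * (C + D) ^+ n.
  move=> x0 xCD; apply: ler_wpM2l; first exact: ltW.
  by apply: lerXn2r => //; rewrite nnegrE ltW // addr_gt0.
by rewrite !exprS mulrDl lerD ?H ?lerDl ?lerDr // ltW.
Qed.

Definition mtilde : {pred A} := fun f => `[< mhat f /\ analytic f >].

Lemma mtilde_zmod_closed : zmod_closed mtilde.
Proof.
have [m0 mD mL _] := @mhat_ideal R[i] Q.
split=> [|f g /asboolP[mf af] /asboolP[mg ag]]; apply/asboolP; split=> //.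
- exact: analytic0.
- by apply: mD => //; rewrite -mulN1r; apply: mL.
- by apply: analyticD => //; apply: analyticN.
Qed.

HB.instance Definition _ := GRing.isZmodClosed.Build A mtilde mtilde_zmod_closed.

Record mtilde_type := MTilde { mt_val :> A; mt_valP : mt_val \in mtilde }.
HB.instance Definition _ := [isSub for mt_val].
HB.instance Definition _ := [Choice of mtilde_type by <:].
HB.instance Definition _ := [SubChoice_isSubZmodule of mtilde_type by <:].

(* The square of the ideal: finite sums of products of two elements.           *)
Definition mtilde2 : {pred mtilde_type} := fun x =>
  `[< exists (n : nat) (u v : 'I_n -> mtilde_type),
        mt_val x = \sum_(k < n) mt_val (u k) * mt_val (v k) >].

Lemma mtilde2_zmod_closed : zmod_closed mtilde2.
Proof.
split=> [|f g /asboolP[m [u [v fE]]] /asboolP[n [u' [v' gE]]]]; apply/asboolP.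
  by exists 0%N, (fun=> 0), (fun=> 0); rewrite big_ord0.
exists (m + n)%N.
exists (fun k : 'I_(m + n) => match fintype.split k with inl i => u i | inr j => - u' j end).
exists (fun k : 'I_(m + n) => match fintype.split k with inl i => v i | inr j => v' j end).
rewrite -[LHS]/(mt_val f - mt_val g) fE gE big_split_ord /= -sumrN; congr (_ + _); apply: eq_bigr => k _.
  by rewrite (unsplitK (inl k)).
by rewrite (unsplitK (inr k)) -[mt_val (- _)]/(- mt_val _) mulNr.
Qed.

HB.instance Definition _ :=
  GRing.isZmodClosed.Build mtilde_type mtilde2 mtilde2_zmod_closed.

Definition cotangent : zmodType := Quotient.quot mtilde2.

Definition to_cotangent (x : mtilde_type) : cotangent := \pi_(Quotient.quot mtilde2)%qT x.

Definition induces (H : A -> A) (h : cotangent -> cotangent) : Prop :=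
  forall x : mtilde_type,
    exists2 y : mtilde_type, mt_val y = H (mt_val x) & h (to_cotangent x) = to_cotangent y.

(* Additivity and linearity of h are automatic, since H is a morphism.         *)
Definition induces_iso (H : A -> A) : Prop :=
  exists2 h : cotangent -> cotangent, induces H h & bijective h.

End Analytic.

(* Main.v *)
(* Write m for the ideal of series without constant term.  An l-algebra
   endomorphism mapping the arrows into m preserves every power of m, so it is
   determined by its values on arrows.  Surjectivity of H on the cotangent space
   gives, for each arrow b, an analytic x_b in m with H x_b = b + u_b and u_b in
   m^2, which makes H surjective by successive approximation; injectivity on the
   cotangent space makes the linear part of H injective, hence H injective.

   The inverse G satisfies G b = x_b - G u_b.  For the truncated norms
   |f|_(r,n) = sum over |w| <= n of |f_w| r^|w|, the bounds |G b|_(r,n) <= s for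
   all arrows b give |G f|_(r,n) <= |f|_(s,n), and even
   |G f|_(r,n+1) <= |f|_(s,n+1) if f is in m^2.  As |x_b|_(r,n) = O(r) and
   |u_b|_(s,n) = O(s^2), the recursion propagates |G b|_(r,n) <= s from n to n+1
   when s, and then r, are small enough.  Analytic series being those with
   bounded |f|_(r,n) for some r > 0, G preserves them. *)

Require Import Defs.
From HB Require Import structures.
From mathcomp Require Import all_boot all_order all_algebra reals.
From mathcomp Require Import boolp ring lra.

Set Implicit Arguments.
Unset Strict Implicit.
Unset Printing Implicit Defensive.

Import Order.TTheory GRing.Theory Num.Theory.
Local Open Scope ring_scope.

(** * Left division by an arrow *)

Section Derivation.
Variables (K : comNzRingType) (Q : quiver).
Local Notation A := (pseries K Q).
Implicit Types (f g : A) (w : qpath Q) (a b : qarr Q).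

Lemma pcons_proof a w : qtgt a == pstart w -> composable (qsrc a) (a :: parrows w).
Proof. by move=> /eqP e; rewrite /= eqxx e Defs.pathP. Qed.

Definition pcons a w (e : qtgt a == pstart w) : qpath Q := QPath (pcons_proof e).

Variant qpath_spec : qpath Q -> Type :=
| QpathTriv i : qpath_spec (ptriv i)
| QpathCons a w e : qpath_spec (@pcons a w e).

Lemma qpathP w : qpath_spec w.
Proof.
case: w => i [|a s] p.
  by rewrite (_ : QPath p = ptriv i); [constructor | apply: qpath_inj].
have /andP[/eqP ei ps] := p.
rewrite (_ : QPath p = @pcons a (QPath ps) (eqxx _)); first by constructor.
exact: qpath_inj.
Qed.

Lemma plen_pcons a w e : plen (@pcons a w e) = (plen w).+1. Proof. by []. Qed.

(** Left division by [a]: the series of the tails [w] of the paths [a w], with value 0 where [a]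
    cannot precede [w]. Inductions on path length run through this operator, which obeys a Fox-type
    product rule. *)
Definition pder a f : A := fun w =>
  if boolP (qtgt a == pstart w) is AltTrue e then f (pcons e) else 0.

Lemma pder_pcons a f w (e : qtgt a == pstart w) : pder a f w = f (pcons e).
Proof.
rewrite /pder; case: {-}_ / boolP => [e'|]; last by rewrite e.
by congr f; apply: qpath_inj.
Qed.

Lemma pder_eq0 a f w : qtgt a != pstart w -> pder a f w = 0.
Proof. by rewrite /pder; case: {-}_ / boolP => // e; rewrite e. Qed.

Lemma pderD a f g : pder a (f + g) = pder a f + pder a g.
Proof.
apply/funext => w; rewrite pseriesDE.
have [e|ne] := boolP (qtgt a == pstart w); first by rewrite !pder_pcons.
by rewrite !pder_eq0 ?addr0.
Qed.

Lemma pder0 a : pder a 0 = 0 :> A.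
Proof. by apply: (@addrI _ (pder a 0)); rewrite -pderD !addr0. Qed.

Lemma pderN a f : pder a (- f) = - pder a f.
Proof. by apply: (@addrI _ (pder a f)); rewrite -pderD !subrr pder0. Qed.

Lemma pmul_ptriv f g i : (f * g) (ptriv i) = f (ptriv i) * g (ptriv i).
Proof.
by rewrite pseriesME big_ord_recl big_ord0 /= addr0; congr (f _ * g _);
  apply: qpath_inj.
Qed.

Lemma pmul_pcons f g a w (e : qtgt a == pstart w) :
  (f * g) (pcons e) = f (ptriv (qsrc a)) * g (pcons e) + (pder a f * g) w.
Proof.
rewrite pseriesME plen_pcons big_ord_recl; congr (f _ * g _ + _).
- exact: qpath_inj.
- exact: qpath_inj.
rewrite pseriesME; apply: eq_bigr => k _.
rewrite (@pder_pcons a f (ptake k w) e); congr (f _ * g _).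
- exact: qpath_inj.
- by apply: qpath_inj => //=; rewrite /pend /= (eqP e).
Qed.

(** The first arrow of a concatenation comes from the left factor unless that factor is trivial. The
    scalar may be spread over all vertices because [pder a g] is supported on paths starting at
    [qtgt a]. *)
Lemma pderM a f g :
  pder a (f * g) = lconst (fun=> f (ptriv (qsrc a))) * pder a g + pder a f * g.
Proof.
apply/funext => w; rewrite pseriesDE -[X in X + _]/(pmul _ _ w) lconstM.
have [e|ne] := boolP (qtgt a == pstart w).
  by rewrite !pder_pcons pmul_pcons.
rewrite !pder_eq0 // mulr0 add0r pseriesME big1 // => k _.
by rewrite pder_eq0 ?mul0r.
Qed.

Lemma lconstE (c : qvert Q -> K) f w : (lconst c * f) w = c (pstart w) * f w.
Proof. exact: lconstM. Qed.

Lemma pder_lconst a (c : qvert Q -> K) : pder a (lconst c) = 0.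
Proof.
apply/funext => w; have [e|ne] := boolP (qtgt a == pstart w).
  by rewrite pder_pcons.
by rewrite pder_eq0.
Qed.

Lemma arrow_seriesM_ptriv b f i : (arrow_series K b * f) (ptriv i) = 0.
Proof. by rewrite pmul_ptriv mul0r. Qed.

Lemma pder_arrow a b : pder a (arrow_series K b) =
  if a == b then lconst (fun i => (i == qtgt a)%:R) else 0.
Proof.
apply/funext => w; have [e|ne] := boolP (qtgt a == pstart w); last first.
  rewrite pder_eq0 //; case: ifP => //= _.
  by rewrite /lconst [_ == qtgt a]eq_sym (negPf ne) if_same.
rewrite pder_pcons /arrow_series /= eqseq_cons; case: eqP => //= _.
by rewrite /lconst /plen size_eq0 (eqP e) eqxx; case: (parrows w).
Qed.

Lemma arrow_seriesM_pcons b f a w (e : qtgt a == pstart w) :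
  (arrow_series K b * f) (pcons e) = if a == b then f w else 0.
Proof.
rewrite pmul_pcons {1}/arrow_series /= mul0r add0r pder_arrow.
by case: ifP => _; rewrite ?mul0r // lconstE (eqP e) eqxx mul1r.
Qed.

(** A nontrivial path has a unique first arrow. The sum is finite, so a ring morphism can be applied
    to it term by term. *)
Lemma pseries_decomp f :
  f = lconst (f \o @ptriv Q) + \sum_a arrow_series K a * pder a f.
Proof.
apply/funext => w; rewrite pseriesDE pseries_sumE.
case/qpathP: w => [i|a w e].
  by rewrite big1 ?addr0 //= => a _; rewrite arrow_seriesM_ptriv.
rewrite [lconst _ _]/= add0r (bigD1 a) //= big1 => [|b /negPf ba].
  by rewrite addr0 arrow_seriesM_pcons eqxx pder_pcons.
by rewrite arrow_seriesM_pcons eq_sym ba.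
Qed.

End Derivation.

(** * The filtration by powers of the arrow ideal *)

Section Order.
Variables (K : comNzRingType) (Q : quiver).
Local Notation A := (pseries K Q).
Implicit Types (f g : A) (w : qpath Q) (a b : qarr Q) (m n : nat).

(** Order at least [n], i.e. membership in the [n]-th power of the arrow ideal. *)
Definition ford n f := forall w, (plen w < n)%N -> f w = 0.

Lemma ford_leq m n f : (m <= n)%N -> ford n f -> ford m f.
Proof. by move=> mn fn w wm; apply: fn; apply: leq_trans mn. Qed.

Lemma fordD n f g : ford n f -> ford n g -> ford n (f + g).
Proof. by move=> fn gn w wn; rewrite pseriesDE fn // gn // addr0. Qed.

Lemma fordN n f : ford n f -> ford n (- f).
Proof. by move=> fn w wn; rewrite pseriesNE fn // oppr0. Qed.

Lemma fordB n f g : ford n f -> ford n g -> ford n (f - g).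
Proof. by move=> fn gn; apply/fordD/fordN. Qed.

Lemma ford_sum n (I : Type) (r : seq I) (P : pred I) (F : I -> A) :
  (forall i, P i -> ford n (F i)) -> ford n (\sum_(i <- r | P i) F i).
Proof. by move=> Fn; elim/big_ind: _ => //; apply: fordD. Qed.

Lemma fordM m n f g : ford m f -> ford n g -> ford (m + n) (f * g).
Proof.
move=> fm gn w wmn; rewrite pseriesME big1 // => -[k /=]; rewrite ltnS => kw _.
have [km|mk] := ltnP k m; first by rewrite fm ?mul0r // plen_take.
by rewrite gn ?mulr0 // plen_drop ltn_subLR // (leq_trans wmn) // leq_add2r.
Qed.

Lemma ford1P f : ford 1 f <-> forall i, f (ptriv i) = 0.
Proof.
split=> [f1 i|f0 w]; first exact: f1.
by case/qpathP: w.
Qed.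

Lemma mhat_ford1 f : mhat f <-> ford 1 f.
Proof. by rewrite mhatP ford1P. Qed.

Lemma fordS n f : ford 1 f -> (forall a, ford n (pder a f)) -> ford n.+1 f.
Proof.
move=> f1 fn w; case/qpathP: w => [i _|a w e]; first exact: f1.
by rewrite plen_pcons ltnS -pder_pcons; apply: fn.
Qed.

Lemma ford_pder n a f : ford n.+1 f -> ford n (pder a f).
Proof.
move=> fn w wn; have [e|ne] := boolP (qtgt a == pstart w); last exact: pder_eq0.
by rewrite pder_pcons fn.
Qed.

Lemma ford_arrow a : ford 1 (arrow_series K a).
Proof. exact/ford1P. Qed.

Lemma mhat_decomp f : ford 1 f -> f = \sum_a arrow_series K a * pder a f.
Proof.
move=> f1; rewrite {1}[f]pseries_decomp (_ : lconst _ = 0) ?add0r //.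
by apply/funext => w; rewrite /lconst /= f1 // if_same.
Qed.

Lemma pderM_mhat a f g : ford 1 f -> pder a (f * g) = pder a f * g.
Proof.
move=> /ford1P f0; rewrite pderM f0 (_ : lconst _ = 0) ?mul0r ?add0r //.
by apply/funext => w; rewrite /lconst if_same.
Qed.

Lemma pder_lconstM a (c : K) f :
  pder a (lconst (fun=> c) * f) = lconst (fun=> c) * pder a f.
Proof. by rewrite pderM pder_lconst mul0r addr0. Qed.

Lemma pder_sum a (I : Type) (r : seq I) (P : pred I) (F : I -> A) :
  pder a (\sum_(i <- r | P i) F i) = \sum_(i <- r | P i) pder a (F i).
Proof. by apply: (big_morph _ (@pderD _ _ a) (pder0 _ a)). Qed.

End Order.

(** * Surjectivity and injectivity of an endomorphism from its linear part *)

Section Endomorphism.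
Variables (K : comNzRingType) (Q : quiver).
Local Notation A := (pseries K Q).
Variable H : {rmorphism A -> A}.
Hypotheses (Hl : l_algebra_endo H)
  (H_mhat : forall a, ford 1 (H (arrow_series K a))).
Implicit Types (f g : A) (w : qpath Q) (a b : qarr Q) (m n : nat).

Lemma endo_decomp f :
  H f = lconst (f \o @ptriv Q) + \sum_a H (arrow_series K a) * H (pder a f).
Proof.
rewrite {1}[f]pseries_decomp rmorphD rmorph_sum /= Hl.
by congr (_ + _); apply: eq_bigr => a _; rewrite rmorphM.
Qed.

Lemma endo_decomp_mhat f : ford 1 f ->
  H f = \sum_a H (arrow_series K a) * H (pder a f).
Proof.
move=> f1; rewrite {1}[f]mhat_decomp // rmorph_sum.
by apply: eq_bigr => a _; rewrite rmorphM.
Qed.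

Lemma endo_ptriv f i : H f (ptriv i) = f (ptriv i).
Proof.
rewrite endo_decomp pseriesDE pseries_sumE big1 ?addr0 // => a _.
by rewrite pmul_ptriv (H_mhat a) // mul0r.
Qed.

(** Continuity of [H] in the arrow-adic topology, by peeling off one arrow at a time. *)
Lemma ford_endo n f : ford n f -> ford n (H f).
Proof.
elim: n f => // n IH f fn; rewrite endo_decomp_mhat; last exact: ford_leq fn.
by apply: ford_sum => a _; apply: (@fordM _ _ 1 n) => //; apply/IH/ford_pder.
Qed.

Lemma endo_surj (x u : qarr Q -> A) :
    (forall b, ford 1 (x b)) -> (forall b, ford 2 (u b)) ->
    (forall b, H (x b) = arrow_series K b + u b) ->
  forall f, exists g, H g = f.
Proof.
move=> x1 u2 Hx.
have approx n f : ford n f -> exists g, ford n g /\ ford n.+1 (f - H g).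
  elim: n f => [|n IH] f fn.
    exists (lconst (f \o @ptriv Q)); split=> //; rewrite Hl.
    by apply/ford1P => i; rewrite pseriesDE pseriesNE /lconst /= subrr.
  have /fin_all_exists[y yP] a := IH _ (ford_pder a fn).
  (* Replacing the first arrow [b] by [x b] leaves two errors, [b * (pder b f - H (y b))] and
     [u b * H (y b)], both of order [n.+2]. *)
  exists (\sum_b x b * y b); split.
    by apply: ford_sum => b _; apply: (@fordM _ _ 1) => //; case: (yP b).
  rewrite {1}[f]mhat_decomp; last exact: ford_leq fn.
  rewrite rmorph_sum -sumrB; apply: ford_sum => b _.
  have [yn fy] := yP b.
  rewrite rmorphM /= Hx mulrDl opprD addrA -mulrBr; apply: fordB.
    by apply: (@fordM _ _ 1) fy; exact: ford_arrow.
  by apply: (@fordM _ _ 2 n) => //; apply: ford_endo.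
move=> f.
(* Choice needs a total relation: pairs whose series lacks the stated order receive the default
   0. *)
have /choice[F FP] : forall p : nat * A, exists g,
    ford p.1 p.2 -> ford p.1 g /\ ford p.1.+1 (p.2 - H g).
  move=> [n h] /=; have [hn|hn] := pselect (ford n h); last by exists 0.
  by have [g gP] := approx n h hn; exists g.
pose rest := fix rest n := if n is m.+1 then rest m - H (F (m, rest m)) else f.
have restP n : ford n (rest n) by elim: n => // n /(FP (n, rest n))[].
pose s n := F (n, rest n).
have sP n : ford n (s n) by case: (FP (n, rest n) (restP n)).
have restE n : rest n = f - H (\sum_(k < n) s k).
  elim: n => [|n IH]; first by rewrite big_ord0 rmorph0 subr0.
  by rewrite big_ord_recr /= rmorphD opprD addrA -IH.
(* The infinite sum of the corrections: [s k] has order [k], so only [k <= plen w] contributes at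
   [w]. *)
pose g : A := fun w => \sum_(k < (plen w).+1) s k w.
exists g; apply/funext => w; apply/eqP; rewrite -subr_eq0 -opprB oppr_eq0.
have gs : ford (plen w).+1 (g - \sum_(k < (plen w).+1) s k).
  move=> v; rewrite ltnS => vw; rewrite pseriesDE pseriesNE pseries_sumE /g.
  rewrite -!(big_mkord xpredT (fun k => s k v)).
  rewrite [X in _ - X](big_cat_nat (n := (plen v).+1)) //= opprD addrA subrr.
  rewrite add0r big_nat_cond big1 ?oppr0 // => k; rewrite andbT => /andP[vk _].
  exact: sP.
(* [f - H g] is a remainder minus the image of a tail, both of order [(plen w).+1], hence zero at
   [w]. *)
have /(_ w) := fordB (restP (plen w).+1) (ford_endo gs).
rewrite restE rmorphB /= opprB addrA subrK => E.
by apply/eqP; apply: E.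
Qed.

(** The hypothesis is injectivity of the linear part of [H] on combinations of arrows. For each tail
    [w] of length one less than the order of [f], the coefficients of [f] at the paths [b w] form
    such a combination, which the linear part of [H] is shown to kill. *)
Lemma ford_endo_inv :
    (forall c : qarr Q -> K,
       ford 2 (H (\sum_a lconst (fun=> c a) * arrow_series K a)) ->
       forall a, c a = 0) ->
  forall n f, ford n (H f) -> ford n f.
Proof.
move=> Hinj; elim=> // n IH f Hfn.
have fn : ford n f by apply: IH; apply: ford_leq Hfn.
case: n => [|n] in IH fn Hfn *.
  by apply/ford1P => i; rewrite -endo_ptriv Hfn.
have f1 : ford 1 f by apply: ford_leq fn.
apply: fordS => // a w; rewrite ltnS leq_eqVlt => /orP[/eqP wn|]; last first.
  exact: ford_pder.
pose c b := pder b f w; rewrite -/(c a).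
have Hlconst b : forall c' g, H (lconst c' * g) = lconst c' * H g.
  by move=> c' g; rewrite rmorphM /= Hl.
apply: Hinj; apply: fordS => [|b].
  apply: ford_endo; apply: ford_sum => b _.
  by apply: (@fordM _ _ 0 1) => //; apply: ford_arrow.
apply/ford1P => i.
rewrite rmorph_sum pder_sum pseries_sumE.
have [iw|iw] := eqVneq i (pstart w); last first.
  rewrite big1 // => d _; rewrite Hlconst // pder_lconstM lconstE.
  have [dw|dw] := eqVneq (qtgt d) (pstart w); last by rewrite /c pder_eq0 ?mul0r.
  (* An arrow absorbs the idempotent of its target, and [H] fixes that idempotent, so [H] of the
     arrow is supported on paths ending there. *)
  have -> : arrow_series K d = arrow_series K d * lconst (fun j => (j == qtgt d)%:R).
    apply/funext => v; rewrite -[RHS]/(pmul _ _ v) Mlconst /arrow_series.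
    by case: eqP => [->|]; rewrite ?mul0r //= /pend /= eqxx mulr1.
  rewrite rmorphM /= Hl pderM_mhat // pmul_ptriv /lconst /= dw (negPf iw).
  by rewrite !mulr0.
(* The matrix of the linear part of [H], with entries in the vertex algebra, which [H] fixes. *)
pose e b d := lconst (fun j => pder b (H (arrow_series K d)) (ptriv j)).
(* The induction hypothesis applies to this sum: up to terms of order [n.+1], its image under [H] is
   [pder b (H f)]. Evaluating at [w] then gives the required linear relation. *)
have : ford n.+1 (\sum_d e b d * pder d f).
  apply: IH; rewrite rmorph_sum.
  have -> : \sum_d H (e b d * pder d f) = pder b (H f) -
      \sum_d (pder b (H (arrow_series K d)) - e b d) * H (pder d f).
    rewrite endo_decomp_mhat // pder_sum -sumrB; apply: eq_bigr => d _.
    by rewrite Hlconst // pderM_mhat // mulrBl opprB addrC subrK.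
  apply: fordB; first exact: ford_pder.
  apply: ford_sum => d _; apply: (@fordM _ _ 1 n).
    by apply/ford1P => j; rewrite pseriesDE pseriesNE /e /lconst /= subrr.
  by apply/ford_endo/ford_pder.
move=> /(_ w); rewrite wn ltnSn pseries_sumE => /(_ isT) E.
rewrite -[RHS]E; apply: eq_bigr => d _.
by rewrite Hlconst // pder_lconstM !lconstE iw mulrC.
Qed.

End Endomorphism.

(** * Truncated weighted norms and analyticity *)

Section TruncatedNorm.
Variables (R : realType) (Q : quiver).
Local Notation A := (pseries R[i] Q).
Implicit Types (f g : A) (w : qpath Q) (a b : qarr Q) (n : nat) (r s t : R).

(** The norm of [R[i]] takes values in [R[i]]; its real part is the modulus as an element of [R]. *)
Definition cabs (z : R[i]) : R := complex.Re `|z|.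

Lemma cabsE z : `|z| = (cabs z)%:C%C.
Proof. by rewrite /cabs RRe_real // normr_real. Qed.

Lemma cabs0 : cabs 0 = 0. Proof. by rewrite /cabs normr0. Qed.

Lemma cabs_ge0 z : 0 <= cabs z.
Proof. by rewrite -lecR -cabsE normr_ge0. Qed.

Lemma cabsD y z : cabs (y + z) <= cabs y + cabs z.
Proof. by rewrite -lecR rmorphD /= -!cabsE ler_normD. Qed.

Lemma cabsM y z : cabs (y * z) = cabs y * cabs z.
Proof. by rewrite /cabs normrM !cabsE -rmorphM. Qed.

Lemma cabsN z : cabs (- z) = cabs z.
Proof. by rewrite /cabs normrN. Qed.

(* The sum of [cabs (f w) * r ^+ plen w] over the paths w of length at most n. *)
Fixpoint pnorm r n f : R :=
  \sum_i cabs (f (ptriv i)) +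
  if n is m.+1 then r * \sum_a pnorm r m (pder a f) else 0.

Lemma pnorm0E r f : pnorm r 0 f = \sum_i cabs (f (ptriv i)).
Proof. by rewrite /= addr0. Qed.

Lemma pnormS r n f :
  pnorm r n.+1 f = pnorm r 0 f + r * \sum_a pnorm r n (pder a f).
Proof. by rewrite pnorm0E. Qed.

Lemma pnorm_ge0 r n f : 0 <= r -> 0 <= pnorm r n f.
Proof.
move=> r0; have p0 h : 0 <= pnorm r 0 h.
  by rewrite pnorm0E; apply: sumr_ge0 => i _; apply: cabs_ge0.
elim: n f => // n IH f; rewrite pnormS addr_ge0 // mulr_ge0 //.
by apply: sumr_ge0.
Qed.

Lemma pnorm_leS r n f : 0 <= r -> pnorm r n f <= pnorm r n.+1 f.
Proof.
move=> r0; elim: n f => [|n IH] f; rewrite pnormS.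
  by rewrite lerDl mulr_ge0 // sumr_ge0 // => a _; apply: pnorm_ge0.
by rewrite [leRHS]pnormS lerD2l ler_wpM2l // ler_sum.
Qed.

Lemma pnorm_const r n f : (forall a, pder a f = 0) -> pnorm r n f = pnorm r 0 f.
Proof.
have p00 : pnorm r 0 0 = 0 by rewrite pnorm0E big1 // => i _; rewrite cabs0.
have p0 : pnorm r n 0 = 0.
  elim: n => // n IH; rewrite pnormS big1 ?mulr0 ?addr0 // => a _.
  by rewrite pder0.
move=> f0; elim: n p0 => // n IH; rewrite !pnormS p00 add0r => p0.
rewrite (eq_bigr (fun a => pnorm r n (pder a 0))) ?p0 ?addr0 // => a _.
by rewrite f0 pder0.
Qed.

Lemma pnorm0 r n : pnorm r n 0 = 0.
Proof.
rewrite pnorm_const => [|a]; last exact: pder0.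
by rewrite pnorm0E big1 // => i _; rewrite cabs0.
Qed.

Lemma pnormD r n f g : 0 <= r -> pnorm r n (f + g) <= pnorm r n f + pnorm r n g.
Proof.
move=> r0; have p0 h k : pnorm r 0 (h + k) <= pnorm r 0 h + pnorm r 0 k.
  by rewrite !pnorm0E -big_split ler_sum // => i _; apply: cabsD.
elim: n f g => // n IH f g; rewrite !pnormS addrACA lerD // -mulrDr.
by rewrite ler_wpM2l // -big_split ler_sum // => a _; rewrite pderD IH.
Qed.

Lemma pnormN r n f : pnorm r n (- f) = pnorm r n f.
Proof.
elim: n f => [|n IH] f.
  by rewrite !pnorm0E; apply: eq_bigr => i _; rewrite cabsN.
rewrite !pnormS !pnorm0E; congr (_ + _ * _); apply: eq_bigr => i _.
  by rewrite cabsN.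
by rewrite pderN.
Qed.

Lemma pnorm_sum r n (I : Type) (l : seq I) (P : pred I) (F : I -> A) : 0 <= r ->
  pnorm r n (\sum_(i <- l | P i) F i) <= \sum_(i <- l | P i) pnorm r n (F i).
Proof.
move=> r0; elim/big_rec2: _ => [|i y x _ IH]; first by rewrite pnorm0.
by apply: (le_trans (pnormD _ _ _ r0)); rewrite lerD2l.
Qed.

Lemma pnorm0_mhat r f : ford 1 f -> pnorm r 0 f = 0.
Proof. by move=> f1; rewrite pnorm0E big1 // => i _; rewrite f1 ?cabs0. Qed.

Lemma cabs_le_pnorm0 r f i : cabs (f (ptriv i)) <= pnorm r 0 f.
Proof.
rewrite pnorm0E (bigD1 i) //= lerDl sumr_ge0 // => j _; exact: cabs_ge0.
Qed.

Lemma pnorm_scale r n (c : R[i]) f :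
  pnorm r n (lconst (fun=> c) * f) = cabs c * pnorm r n f.
Proof.
elim: n f => [|n IH] f.
  by rewrite !pnorm0E mulr_sumr; apply: eq_bigr => i _; rewrite lconstE cabsM.
rewrite !pnormS !pnorm0E mulrDr mulrCA; congr (_ + _ * _); rewrite mulr_sumr.
  by apply: eq_bigr => i _; rewrite lconstE cabsM.
by apply: eq_bigr => a _; rewrite pder_lconstM IH.
Qed.

Lemma pnormM r n f g : 0 <= r -> pnorm r n (f * g) <= pnorm r n f * pnorm r n g.
Proof.
move=> r0.
have p0 h k : pnorm r 0 (h * k) <= pnorm r 0 h * pnorm r 0 k.
  rewrite ![pnorm _ _ (_ * _)]pnorm0E [X in _ <= X * _]pnorm0E mulr_suml.
  rewrite ler_sum // => i _.
  by rewrite pmul_ptriv cabsM ler_wpM2l ?cabs_ge0 // cabs_le_pnorm0.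
elim: n f g => // n IH f g.
rewrite pnormS.
(* The two terms of the product rule: the first arrow comes from [g] after a trivial path of [f], or
   from [f]. *)
have le1 : r * \sum_a pnorm r n (pder a (f * g)) <=
    pnorm r 0 f * (r * \sum_a pnorm r n (pder a g)) +
    (r * \sum_a pnorm r n (pder a f)) * pnorm r n g.
  rewrite mulrCA -[X in _ <= _ + X]mulrA -mulrDr ler_wpM2l //.
  rewrite mulr_sumr mulr_suml -big_split ler_sum // => a _; rewrite pderM.
  apply: (le_trans (pnormD _ _ _ r0)); rewrite pnorm_scale.
  by rewrite lerD ?IH // ler_wpM2r ?pnorm_ge0 // cabs_le_pnorm0.
apply: (le_trans (lerD (p0 f g) le1)).
rewrite [X in _ <= X * _]pnormS [in leRHS]mulrDl addrA -mulrDr -pnormS lerD2l.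
by rewrite ler_wpM2l ?pnorm_leS // mulr_ge0 // sumr_ge0 // => a _; rewrite pnorm_ge0.
Qed.

(** A left factor without constant term uses up at least one arrow, leaving at most [n] for [g]. *)
Lemma pnormM_mhatl r n f g : 0 <= r -> ford 1 f ->
  pnorm r n.+1 (f * g) <= pnorm r n.+1 f * pnorm r n g.
Proof.
move=> r0 f1; have fg1 : ford 1 (f * g) by apply: (@fordM _ _ 1 0).
rewrite !pnormS !pnorm0_mhat // !add0r -mulrA ler_wpM2l // mulr_suml ler_sum //.
by move=> a _; rewrite pderM_mhat // pnormM.
Qed.

(** The mirror image requires an induction, since [pder] strips arrows on the left only. *)
Lemma pnormM_mhatr r n f g : 0 <= r -> ford 1 g ->
  pnorm r n.+1 (f * g) <= pnorm r n f * pnorm r n.+1 g.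
Proof.
move=> r0 g1; elim: n f => [|n IH] f.
  rewrite pnormS pnorm0_mhat; last exact: (@fordM _ _ 0 1).
  rewrite add0r [X in _ <= _ * X]pnormS [pnorm _ 0 g]pnorm0_mhat // add0r.
  rewrite mulrCA ler_wpM2l // mulr_sumr ler_sum // => a _; rewrite pderM.
  apply: (le_trans (pnormD _ _ _ r0)); rewrite pnorm_scale.
  rewrite [X in _ + X]pnorm0_mhat ?addr0; last exact: (@fordM _ _ 0 1).
  by rewrite ler_wpM2r ?pnorm_ge0 // cabs_le_pnorm0.
rewrite pnormS pnorm0_mhat; last exact: (@fordM _ _ 0 1).
rewrite add0r [X in _ <= X * _]pnormS mulrDl.
rewrite [X in _ <= _ * X + _]pnormS [pnorm _ 0 g]pnorm0_mhat // add0r.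
rewrite mulrCA -[X in _ <= _ + X]mulrA -mulrDr ler_wpM2l //.
rewrite mulr_sumr mulr_suml -big_split ler_sum // => a _; rewrite pderM.
apply: (le_trans (pnormD _ _ _ r0)); rewrite pnorm_scale.
apply: lerD; first by rewrite ler_wpM2r ?pnorm_ge0 // cabs_le_pnorm0.
by apply: (le_trans (IH _)); rewrite ler_wpM2l ?pnorm_ge0 // pnorm_leS.
Qed.

(** Each factor uses up an arrow, so both truncations drop to [n]. This gain drives the recursion
    for the inverse. *)
Lemma pnormM_mhat r n f g : 0 <= r -> ford 1 f -> ford 1 g ->
  pnorm r n.+1 (f * g) <= pnorm r n f * pnorm r n g.
Proof.
move=> r0 f1 g1.
rewrite pnormS pnorm0_mhat ?add0r; last exact: (@fordM _ _ 1 0).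
case: n => [|n].
  rewrite [X in _ <= X * _]pnorm0_mhat // mul0r big1 ?mulr0 // => a _.
  by rewrite pderM_mhat // pnorm0_mhat //; apply: (@fordM _ _ 0 1).
rewrite [X in _ <= X * _]pnormS [pnorm _ 0 f]pnorm0_mhat // add0r -mulrA.
rewrite ler_wpM2l // mulr_suml ler_sum // => a _; rewrite pderM_mhat //.
exact: pnormM_mhatr.
Qed.

(** Shrinking the radius by [t] multiplies the weight of a path of length at least [k] by at most
    [t ^+ k]. *)
Lemma pnorm_radius t r k n f : 0 <= r -> 0 <= t <= 1 -> ford k f ->
  pnorm (t * r) n f <= t ^+ k * pnorm r n f.
Proof.
move=> r0 /andP[t0 t1]; elim: n k f => [|n IH] [|k] f fk.
- by rewrite expr0 mul1r !pnorm0E.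
- by rewrite !pnorm0_mhat ?mulr0 //; exact: ford_leq fk.
- rewrite expr0 mul1r !pnormS !pnorm0E lerD2l.
  have le1 : \sum_a pnorm (t * r) n (pder a f) <= \sum_a pnorm r n (pder a f).
    by apply: ler_sum => a _; rewrite -[leRHS]mul1r -(expr0 t) IH.
  apply: (le_trans _ (ler_wpM2l r0 le1)).
  rewrite -mulrA ler_piMl // mulr_ge0 // sumr_ge0 // => a _.
  by rewrite pnorm_ge0 // mulr_ge0.
rewrite !pnormS !pnorm0_mhat; [|exact: ford_leq fk..].
rewrite !add0r exprS -!mulrA ler_wpM2l //.
rewrite mulrCA ler_wpM2l // mulr_sumr ler_sum // => a _.
exact/IH/ford_pder.
Qed.

Lemma pnorm_le_radius r s n f : 0 <= r <= s -> pnorm r n f <= pnorm s n f.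
Proof.
move=> /andP[r0 rs]; elim: n f => [|n IH] f; first by rewrite !pnorm0E.
rewrite !pnormS !pnorm0E lerD2l ler_pM // ?ler_sum // sumr_ge0 // => a _.
exact: pnorm_ge0.
Qed.

Lemma coef_le_pnorm r f w : 0 <= r -> cabs (f w) * r ^+ plen w <= pnorm r (plen w) f.
Proof.
move=> r0; have [n] := ubnP (plen w); elim: n f w => // n IH f w.
case/qpathP: w => [i _|a w e].
  by rewrite expr0 mulr1 cabs_le_pnorm0.
rewrite plen_pcons ltnS => wn; rewrite pnormS exprS mulrCA -pder_pcons.
apply: (le_trans (ler_wpM2l r0 (IH (pder a f) _ wn))).
rewrite -[leLHS]add0r lerD ?pnorm_ge0 // ler_wpM2l // (bigD1 a) //= lerDl.
by rewrite sumr_ge0 // => b _; apply: pnorm_ge0.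
Qed.

Definition pnorm_bounded f : Prop :=
  exists2 r, 0 < r & exists B, forall n, pnorm r n f <= B.

Lemma pnorm_bounded_analytic f : pnorm_bounded f -> analytic f.
Proof.
(* With [C] at least 1 and [B], the constant [B] is absorbed into [C ^+ plen w] as soon as [plen w]
   is positive. *)
move=> [r r0 [B fB]]; pose C := Num.max 1 B.
have C1 : 1 <= C by rewrite le_max lexx.
have C0 : 0 < C by apply: lt_le_trans C1.
exists (C / r); split; first exact: divr_gt0.
exists 1%N => w w1; rewrite cabsE lecR expr_div_n ler_pdivlMr ?exprn_gt0 //.
apply: (le_trans (coef_le_pnorm _ _ (ltW r0))); apply: (le_trans (fB _)).
have BC : B <= C by rewrite le_max lexx orbT.
by apply: (le_trans BC); rewrite -[leLHS]expr1; apply: ler_weXn2l.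
Qed.

(** There are at most [#|qvert Q| * #|qarr Q| ^ k] paths of length [k], so a geometric series of
    ratio at most one half dominates. In the induction, [pder] turns the constant [K] into
    [K * C]. *)
Lemma geometric_pnorm_bounded r (K C : R) f :
    0 <= r -> 0 <= K -> 0 <= C -> r * C * #|qarr Q|%:R <= 2^-1 ->
    (forall w, cabs (f w) <= K * C ^+ plen w) ->
  forall n, pnorm r n f <= 2 * K * #|qvert Q|%:R.
Proof.
move=> r0 K0 C0 rC fK n.
have le0 L g : (forall w, cabs (g w) <= L * C ^+ plen w) ->
    pnorm r 0 g <= L * #|qvert Q|%:R.
  move=> gL; rewrite pnorm0E; apply: (@le_trans _ _ (\sum_(i : qvert Q) L)).
    by apply: ler_sum => i _; apply: (le_trans (gL _)); rewrite expr0 mulr1.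
  by rewrite sumr_const mulr_natr.
elim: n K K0 f fK => [|n IH] K K0 f fK.
  by have := le0 K f fK; have := ler0n R #|qvert Q|; nra.
rewrite pnormS; have := le0 K f fK.
have le1 : \sum_a pnorm r n (pder a f) <=
    2 * (K * C) * #|qvert Q|%:R * #|qarr Q|%:R.
  apply: (@le_trans _ _ (\sum_(a : qarr Q) 2 * (K * C) * #|qvert Q|%:R)).
    apply: ler_sum => a _; apply: IH => [|w]; first exact: mulr_ge0.
    have [e|ne] := boolP (qtgt a == pstart w).
      by rewrite pder_pcons; apply: (le_trans (fK _)); rewrite plen_pcons exprS mulrA.
    by rewrite pder_eq0 // cabs0 !mulr_ge0 // exprn_ge0.
  by rewrite sumr_const -[leLHS]mulr_natr.
have := ler_wpM2l r0 le1.
have : 2 * (K * #|qvert Q|%:R) * (r * C * #|qarr Q|%:R) <= 2 * (K * #|qvert Q|%:R) * 2^-1.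
  by rewrite ler_wpM2l // !mulr_ge0.
lra.
Qed.

Lemma analytic_pnorm_bounded f : analytic f -> pnorm_bounded f.
Proof.
move=> [C [C0 [N fN]]].
pose q : R := #|qarr Q|%:R.
have q0 : 0 <= q by apply: ler0n.
(* Using [q + 1] keeps the denominator nonzero when there are no arrows. *)
pose r := (2 * C * (q + 1))^-1.
have r0 : 0 < r by rewrite invr_gt0 !mulr_gt0 // ltr_wpDl.
have rC : r * C * q <= 2^-1.
  have -> : r * C * q = 2^-1 * (q / (q + 1)).
    by rewrite /r; field; rewrite !gt_eqF // ltr_wpDl.
  rewrite ler_piMr ?invr_ge0 ?ler0n // ler_pdivrMr ?ltr_wpDl //.
  by rewrite mul1r lerDl.
exists r => //.
have {fN} : forall w, (N <= plen w)%N -> cabs (f w) <= 1 * C ^+ plen w.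
  by move=> w /fN; rewrite cabsE lecR mul1r.
(* The constant is generalized for an induction on the threshold [N]: passing to [pder a f] lowers
   [N] by one and replaces [K] by [K * C]. *)
have : 0 <= 1 :> R by []; move: (1 : R) => K.
elim: N K f => [|N IH] K f K0 fK.
  exists (2 * K * #|qvert Q|%:R).
  apply: (geometric_pnorm_bounded (ltW r0) K0 (ltW C0) rC) => w; exact: fK.
have /fin_all_exists[B fB] a : exists B, forall n, pnorm r n (pder a f) <= B.
  apply: (IH (K * C)); first by rewrite mulr_ge0 // ltW.
  move=> w wN; have [e|ne] := boolP (qtgt a == pstart w).
    by rewrite pder_pcons -mulrA -exprS fK.
  by rewrite pder_eq0 // cabs0 !mulr_ge0 ?exprn_ge0 // ltW.
have B0 a : 0 <= B a by apply: le_trans (fB a 0%N); apply: pnorm_ge0; apply: ltW.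
exists (pnorm r 0 f + r * \sum_a B a) => -[|n].
  by rewrite lerDl mulr_ge0 ?(ltW r0) // sumr_ge0.
by rewrite pnormS lerD2l ler_wpM2l ?(ltW r0) // ler_sum.
Qed.

Lemma analyticE f : analytic f <-> pnorm_bounded f.
Proof. by split; [apply: analytic_pnorm_bounded | apply: pnorm_bounded_analytic]. Qed.

Lemma analytic_pder a f : analytic f -> analytic (pder a f).
Proof.
move=> /analyticE[r r0 [B fB]]; apply/analyticE; exists r => //.
exists (B / r) => n; rewrite ler_pdivlMr // mulrC.
apply: le_trans (fB n.+1); rewrite pnormS -[leLHS]add0r lerD ?pnorm_ge0 ?(ltW r0) //.
rewrite ler_pM2l // (bigD1 a) //= lerDl sumr_ge0 // => b _.
by rewrite pnorm_ge0 // ltW.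
Qed.

Lemma analytic_polynomial N f : (forall w, (N <= plen w)%N -> f w = 0) -> analytic f.
Proof.
move=> fN; exists 1; split=> //; exists N => w /fN ->.
by rewrite normr0 expr1n lecR.
Qed.

(** Sums of inverse radii and of bounds stand in for minimum and maximum; the added 1 keeps both
    positive when [I] is empty. *)
Lemma analytic_family (I : finType) (F : I -> A) : (forall i, analytic (F i)) ->
  exists2 r, 0 < r & exists2 B, 0 < B & forall i n, pnorm r n (F i) <= B.
Proof.
move=> Fan.
have /fin_all_exists2[r r0 /fin_all_exists[B FB]] i :
  exists2 r, 0 < r & exists B, forall n, pnorm r n (F i) <= B by exact/analyticE.
have B0 i : 0 <= B i by apply: le_trans (FB i 0%N); apply: pnorm_ge0; apply: ltW.
pose c := 1 + \sum_i (r i)^-1.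
have c0 : 0 < c by rewrite ltr_pwDl // sumr_ge0 // => i _; rewrite invr_ge0 ltW.
exists c^-1; rewrite ?invr_gt0 //; exists (1 + \sum_i B i).
  by rewrite ltr_pwDl // sumr_ge0.
move=> i n; apply: (@le_trans _ _ (B i)); last first.
  rewrite (bigD1 i) //= addrCA lerDl addr_ge0 // sumr_ge0 //.
apply: le_trans (FB i n); apply: pnorm_le_radius; rewrite invr_ge0 ltW //=.
rewrite -[leRHS]invrK lef_pV2 ?posrE ?invr_gt0 // /c (bigD1 i) //= addrCA lerDl.
by rewrite addr_ge0 // sumr_ge0 // => j _; rewrite invr_ge0 ltW.
Qed.

End TruncatedNorm.

Lemma small_factor (R : realFieldType) (c d : R) : 0 <= c -> 0 < d ->
  exists t, [/\ 0 < t, t <= 1 & t * c <= d].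
Proof.
move=> c0 d0; have dc : 0 < d + c by rewrite ltr_wpDr.
exists (d / (d + c)); split; first exact: divr_gt0.
  by rewrite ler_pdivrMr // mul1r lerDl.
by rewrite mulrAC ler_pdivrMr // ler_wpM2l ?lerDr // ltW.
Qed.

(** * Norm estimates for an endomorphism and analyticity of the inverse *)

Section EndomorphismNorm.
Variables (R : realType) (Q : quiver).
Local Notation A := (pseries R[i] Q).
Variable G : {rmorphism A -> A}.
Hypotheses (Gl : l_algebra_endo G)
  (G_mhat : forall a, ford 1 (G (arrow_series R[i] a))).
Implicit Types (f : A) (a b : qarr Q) (n : nat) (r s : R).

(** Substitution estimate: each arrow of [f] is replaced by a series of norm at most [s], and
    [pnormM_mhatl] matches the truncations. *)
Lemma pnorm_endo r s n f : 0 <= r -> 0 <= s ->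
    (forall a, pnorm r n (G (arrow_series R[i] a)) <= s) ->
  pnorm r n (G f) <= pnorm s n f.
Proof.
move=> r0 s0; elim: n f => [|n IH] f Gs.
  by rewrite !pnorm0E ler_sum // => i _; rewrite endo_ptriv.
rewrite endo_decomp //; apply: (le_trans (pnormD _ _ _ r0)).
rewrite [leRHS]pnormS; apply: lerD.
  rewrite pnorm_const => [|a]; last exact: pder_lconst.
  by rewrite !pnorm0E.
apply: (le_trans (pnorm_sum _ _ _ _ r0)); rewrite mulr_sumr ler_sum // => a _.
apply: (le_trans (pnormM_mhatl _ _ r0 _)) => //.
rewrite ler_pM ?pnorm_ge0 // IH // => b.
by apply: le_trans (Gs b); apply: pnorm_leS.
Qed.

(** Both [G a] and [G (pder a f)] lack a constant term, so bounds up to length [n] control their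
    product up to [n.+1]. *)
Lemma pnorm_endo_mhat2 r s n f : 0 <= r -> 0 <= s -> ford 2 f ->
    (forall a, pnorm r n (G (arrow_series R[i] a)) <= s) ->
  pnorm r n.+1 (G f) <= pnorm s n.+1 f.
Proof.
move=> r0 s0 f2 Gs.
rewrite endo_decomp_mhat //; last exact: ford_leq f2.
apply: (le_trans (pnorm_sum _ _ _ _ r0)).
rewrite [leRHS]pnormS [pnorm _ 0 f]pnorm0_mhat ?add0r; last exact: ford_leq f2.
rewrite mulr_sumr ler_sum // => a _.
apply: (le_trans (pnormM_mhat _ r0 _ _)) => //.
  by apply: ford_endo => //; apply: ford_pder.
by rewrite ler_pM ?pnorm_ge0 // pnorm_endo.
Qed.

Lemma analytic_endo_of_recursion (x u : qarr Q -> A) :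
    (forall b, analytic (x b)) -> (forall b, analytic (u b)) ->
    (forall b, ford 1 (x b)) -> (forall b, ford 2 (u b)) ->
    (forall b, G (arrow_series R[i] b) = x b - G (u b)) ->
  analytic_endo G.
Proof.
move=> xan uan x1 u2 Grec f /analyticE[sg sg0 [Bf fB]].
(* The boolean index puts all [x b] and [u b] in one family, with a common radius and bound. *)
have [rho rho0 [B B0 FB]] := @analytic_family R Q (qarr Q * bool)%type
  (fun p => if p.2 then x p.1 else u p.1) (fun p =>
   if p.2 as c return analytic (if c then x p.1 else u p.1) then xan p.1 else uan p.1).
have xB b n : pnorm rho n (x b) <= B by exact: (FB (b, true)).
have uB b n : pnorm rho n (u b) <= B by exact: (FB (b, false)).
(* [t1] will ensure [s <= sg]; [t2] gives [t ^+ 2 * B <= s / 2] for the terms [u b]; once [s] is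
   fixed, [v] gives [v * B <= s / 2] for the terms [x b]. *)
have [t1 [t10 t11 t1B]] := small_factor (ltW rho0) sg0.
have rho20 : 0 < rho / 2 by rewrite divr_gt0.
have [t2 [t20 t21 t2B]] := small_factor (ltW B0) rho20.
have [t [t0 tt1 tt2]] : exists t, [/\ 0 < t, t <= t1 & t <= t2].
  exists (t1 * t2); split; first exact: mulr_gt0.
    by rewrite ler_piMr // ltW.
  by rewrite ler_piMl // ltW.
pose s := t * rho.
have s0 : 0 < s by apply: mulr_gt0.
have ssg : s <= sg by apply: le_trans t1B; rewrite ler_wpM2r // ltW.
have s20 : 0 < s / 2 by rewrite divr_gt0.
have [v [v0 v1 vB]] := small_factor (ltW B0) s20.
pose r := v * rho.
have r0 : 0 < r by apply: mulr_gt0.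
have Gs n : forall a, pnorm r n (G (arrow_series R[i] a)) <= s.
  elim: n => [|n IH] b; first by rewrite pnorm0_mhat // ltW.
  rewrite Grec; apply: (le_trans (pnormD _ _ _ (ltW r0))); rewrite pnormN.
  have -> : s = s / 2 + s / 2 by lra.
  apply: lerD.
    apply: le_trans vB; apply: (le_trans (pnorm_radius _ (ltW rho0) _ (x1 b))).
      by rewrite ltW.
    by rewrite expr1 ler_wpM2l ?(ltW v0).
  apply: (le_trans (pnorm_endo_mhat2 (ltW r0) (ltW s0) (u2 b) IH)).
  apply: (le_trans (pnorm_radius _ (ltW rho0) _ (u2 b))).
    by rewrite ltW //= (le_trans tt1).
  apply: (@le_trans _ _ (t ^+ 2 * B)).
    by rewrite ler_wpM2l ?exprn_ge0 // ltW.
  rewrite expr2 /s -!mulrA ler_wpM2l ?(ltW t0) //.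
  by apply: le_trans t2B; rewrite ler_wpM2r // ltW.
apply/analyticE; exists r => //; exists Bf => n.
apply: le_trans (fB n); apply: (le_trans (pnorm_endo _ (ltW r0) (ltW s0) (Gs n))).
by apply: pnorm_le_radius; rewrite ltW.
Qed.

End EndomorphismNorm.

(** * The cotangent space as series modulo order two *)

Section Cotangent.
Variables (R : realType) (Q : quiver).
Local Notation A := (pseries R[i] Q).
Implicit Types (f : A) (a b : qarr Q) (x y : mtilde_type R Q).

Lemma mtildeP f : reflect (ford 1 f /\ analytic f) (f \in @mtilde R Q).
Proof. by apply: (iffP (asboolP _)); rewrite mhat_ford1. Qed.

Lemma arrow_mtilde a : arrow_series R[i] a \in @mtilde R Q.
Proof.
apply/mtildeP; split; first exact: ford_arrow.
apply: (@analytic_polynomial _ _ 2) => w; rewrite /arrow_series /plen.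
by case: eqP => // ->.
Qed.

(** An analytic [z] of order 2 is the finite sum of the products [a * pder a z], whose factors are
    analytic without constant term; hence it lies in the algebraic square of the ideal. *)
Lemma to_cotangent_eq x y :
  to_cotangent x = to_cotangent y <-> ford 2 (mt_val x - mt_val y).
Proof.
have -> : (to_cotangent x = to_cotangent y) <-> (x - y \in @mtilde2 R Q).
  by rewrite Quotient.idealrBE; split=> [/eqP|/eqP].
rewrite -[mt_val x - _]/(mt_val (x - y)); move: (x - y) => z.
split=> [/asboolP[n [u [v ->]]]|z2].
  apply: ford_sum => k _; apply: (@fordM _ _ 1 1).
    by have /mtildeP[] := mt_valP (u k).
  by have /mtildeP[] := mt_valP (v k).
have /mtildeP[z1 zan] := mt_valP z.
have dm a : pder a (mt_val z) \in @mtilde R Q.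
  by apply/mtildeP; split; [apply: ford_pder | apply: analytic_pder].
apply/asboolP; exists #|qarr Q|.
exists (fun k => MTilde (arrow_mtilde (enum_val k))), (fun k => MTilde (dm (enum_val k))).
rewrite {1}[mt_val z]mhat_decomp // (reindex (@enum_val _ (qarr Q))) //=.
exact/onW_bij/enum_val_bij.
Qed.

End Cotangent.

(** * Consequences of the cotangent isomorphism, and the inverse *)

Section Inverse.
Variables (R : realType) (Q : quiver).
Local Notation A := (pseries R[i] Q).
Variable H : {rmorphism A -> A}.
Hypotheses (Hl : l_algebra_endo H) (Hiso : induces_iso H).

Lemma induces_iso_arrow a : ford 1 (H (arrow_series R[i] a)).
Proof.
have [h Hh _] := Hiso; have [y <- _] := Hh (MTilde (arrow_mtilde R a)).
by have /mtildeP[] := mt_valP y.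
Qed.

Lemma induces_iso_lift b : exists x : mtilde_type R Q,
  [/\ analytic (H (mt_val x) - arrow_series R[i] b)
    & ford 2 (H (mt_val x) - arrow_series R[i] b)].
Proof.
have [h Hh [g gh hg]] := Hiso; pose ab := MTilde (arrow_mtilde R b).
pose z := g (to_cotangent ab).
exists (repr z); have [y <- hy] := Hh (repr z); split.
  apply: analyticD; first by have /mtildeP[] := mt_valP y.
  by apply: analyticN; have /mtildeP[] := arrow_mtilde R b.
apply/(to_cotangent_eq y ab); rewrite -hy /to_cotangent reprK; exact: hg.
Qed.

Lemma induces_iso_linear_inj (c : qarr Q -> R[i]) :
    ford 2 (H (\sum_a lconst (fun=> c a) * arrow_series R[i] a)) ->
  forall a, c a = 0.
Proof.
have [h Hh [g gh hg]] := Hiso; set v := \sum_a _ => Hv2.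
have vm : v \in @mtilde R Q.
  apply/mtildeP; split.
    apply: ford_sum => a _; apply: (@fordM _ _ 0 1) => //; exact: ford_arrow.
  apply: (@analytic_polynomial _ _ 2) => w w2; rewrite /v pseries_sumE big1 // => a _.
  rewrite lconstE /arrow_series; case: eqP => [e|]; last by rewrite mulr0.
  by rewrite /plen e in w2.
(* [h] is a bare map, so the class of [v] is compared with that of 0 through their images. *)
have [y yE hy] := Hh (MTilde vm); have [y0 y0E hy0] := Hh 0.
have : to_cotangent (MTilde vm) = to_cotangent 0.
  apply: (can_inj gh); rewrite hy hy0; apply/to_cotangent_eq.
  by rewrite yE y0E rmorph0 subr0.
move=> /to_cotangent_eq; rewrite [mt_val 0]/(0 : A) subr0 => v2 a.
have := v2 (parrow a) isT; rewrite /= /v pseries_sumE (bigD1 a) //= big1 => [|b ba].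
  by rewrite addr0 lconstE /arrow_series /= eqxx mulr1.
by rewrite lconstE /arrow_series /= eqseq_cons andbT eq_sym (negPf ba) mulr0.
Qed.

End Inverse.

Theorem proposition3p13 (R : realType) (Q : quiver)
    (H : {rmorphism pseries R[i] Q -> pseries R[i] Q}) :
  l_algebra_endo H -> analytic_endo H -> induces_iso H ->
  exists G : {rmorphism pseries R[i] Q -> pseries R[i] Q},
    [/\ l_algebra_endo G, cancel H G, cancel G H & analytic_endo G].
Proof.
move=> Hl _ Hiso.
have H1 := induces_iso_arrow Hiso.
have /fin_all_exists[x xP] := induces_iso_lift Hiso.
pose u b := H (mt_val (x b)) - arrow_series R[i] b.
have x1 b : ford 1 (mt_val (x b)) by have /mtildeP[] := mt_valP (x b).
have xan b : analytic (mt_val (x b)) by have /mtildeP[] := mt_valP (x b).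
have uan b : analytic (u b) by case: (xP b).
have u2 b : ford 2 (u b) by case: (xP b).
have Hx b : H (mt_val (x b)) = arrow_series R[i] b + u b by rewrite addrC subrK.
have Hford := ford_endo_inv Hl H1 (induces_iso_linear_inj Hiso).
have /choice[G0 HG0] := endo_surj Hl H1 x1 u2 Hx.
(* If [H f = H g], the image of [f - g] has every order, hence so does [f - g]. *)
have Hinj : injective H.
  move=> f g fg; apply/eqP; rewrite -subr_eq0; apply/eqP/funext => w.
  by apply: (Hford (plen w).+1) => // v _; rewrite rmorphB /= fg subrr.
have G0H : cancel H G0 by move=> f; apply: Hinj; rewrite HG0.
pose G0B := GRing.isZmodMorphism.Build _ _ G0 (can2_zmod_morphism G0H HG0).
pose G0M := GRing.isMonoidMorphism.Build _ _ G0 (can2_monoid_morphism G0H HG0).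
pose G : {rmorphism pseries R[i] Q -> pseries R[i] Q} := HB.pack G0 G0B G0M.
exists G.
have Gl : l_algebra_endo G by move=> c; apply: Hinj; rewrite Hl; exact: HG0.
have G1 a : ford 1 (G (arrow_series R[i] a)).
  by apply: Hford; rewrite [H _]HG0; apply: ford_arrow.
split=> //; apply: (analytic_endo_of_recursion Gl G1 xan uan x1 u2) => b.
(* The recursion is [G] applied to [Hx b]. *)
by rewrite -[mt_val (x b)]G0H Hx -[G0 _]/(G _) rmorphD addrK.
Qed.
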